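(* Consider the two problems $$(\tilde P)\quad \text{find } \mathbf{x}\in\mathbf{X} \text{ such that } 0\in\partial[\operatorname{cl}(\mathbf{f}\Box\iota_{\Delta})](\mathbf{x})+(\operatorname{Id}-\mathbf{R})\mathbf{x}\ \text{ and }\ \mathbf{x}\in\Delta^{\perp},$$ $$(\tilde D)\quad \text{find } \mathbf{y}\in\mathbf{X} \text{ such that } 0\in\partial(\mathbf{f}^*+\iota_{\Delta}^* )(\mathbf{y})+\tfrac12\mathbf{y}+T\mathbf{y}.$$ Then: (i) $(\tilde D)$ has a unique solution. (ii) $(\tilde P)$ is the Attouch-Théra dual of $(\tilde D)$ associated with the ordered pair $(\partial(\mathbf{f}^*+\iota_{\Delta}^* ),\ \tfrac12\operatorname{Id}+T)$ (that is, the Attouch-Théra dual inclusion of this pair is equivalent to $(\tilde P)$), and $(\tilde P)$ has a unique solution.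
   Context: $X$ is a real Hilbert space, $m\in\{1,2,\dots\}$, $\mathbf{X}=X^m$ is the product Hilbert space with $\langle\mathbf{x},\mathbf{z}\rangle=\sum_{i=1}^m\langle x_i,z_i\rangle$. $\Delta=\{(x,\dots,x): x\in X\}\subseteq\mathbf{X}$, $\Delta^\perp$ is its orthogonal complement, and $\mathbf{R}:\mathbf{X}\to\mathbf{X}$, $(x_1,\dots,x_m)\mapsto(x_m,x_1,\dots,x_{m-1})$. $T=\frac{1}{2m}\sum_{k=1}^{m-1}(m-2k)\mathbf{R}^k$. $f_1,\dots,f_m$ are proper lower semicontinuous convex functions $X\to\,]-\infty,+\infty]$, and $\mathbf{f}(x_1,\dots,x_m)=\sum_{i=1}^m f_i(x_i)$. $\mathbf{f}^*$ is the Fenchel conjugate, $\iota_\Delta$ the indicator function of $\Delta$ (so $\iota_\Delta^*=\iota_{\Delta^\perp}$), $(\mathbf{f}\Box\iota_\Delta)(\mathbf{x})=\inf_{\mathbf{u}\in\mathbf{X}}(\mathbf{f}(\mathbf{u})+\iota_\Delta(\mathbf{x}-\mathbf{u}))$ is the infimal convolution, $\operatorname{cl}$ denotes the lower semicontinuous hull, and $\partial$ the convex subdifferential. Standing assumption: $\operatorname{dom}\mathbf{f}^*\cap\Delta^\perp\neq\varnothing$. For maximally monotone operators $A,B$ on a Hilbert space, the Attouch-Théra dual, associated with the ordered pair $(A,B)$, of the problem ''find $x$ with $0\in Ax+Bx$'' is the problem ''find $x^*$ with $0\in A^{-1}x^*+\widetilde{B}(x^* )$'', where $\widetilde{B}=(-\operatorname{Id})\circ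 B^{-1}\circ(-\operatorname{Id})$. *)

(* Defs.v *)
From HB Require Import structures.
From mathcomp Require Import all_boot all_order all_algebra sesquilinear.
From mathcomp Require Import all_classical all_reals all_analysis.
From mathcomp Require Import ring.
Set Implicit Arguments.
Unset Strict Implicit.
Unset Printing Implicit Defensive.
Import Order.TTheory GRing.Theory Num.Theory.
Import numFieldNormedType.Exports.
Local Open Scope classical_set_scope.
Local Open Scope ring_scope.

HB.mixin Record CompleteNormedModule_isHilbert (R : realType) X
    & CompleteNormedModule R X := {
  inner : {dot X for idfun};
  innerxx : forall x : X, inner x x = `|x| ^+ 2
}.

#[short(type="hilbertType")]
HB.structure Definition Hilbert (R : realType) :=
  {X of CompleteNormedModule R X & CompleteNormedModule_isHilbert R X}.

Section DotReal.
Context (R : realType) (U : lmodType R) (d : {dot U for idfun}).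

Lemma dot_sym x y : d x y = d y x.
Proof. by rewrite hermC /= expr0 mul1r. Qed.

Lemma dot_ge0 x : 0 <= d x x.
Proof.
have [->|x0] := eqVneq x 0; first by rewrite linear0l.
exact/ltW/neq0_dnorm_gt0.
Qed.

Lemma dot_eq0 x : d x x = 0 -> x = 0.
Proof.
move=> dx0; apply/eqP; apply: contraT => x0.
by have := @neq0_dnorm_gt0 _ _ _ d x x0; rewrite dx0 ltxx.
Qed.

Lemma dotDD x y : d (x + y) (x + y) = d x x + d x y *+ 2 + d y y.
Proof.
by rewrite linearDl !linearDr/= (dot_sym y x) mulr2n !addrA.
Qed.

Lemma dotZZ a b x y : d (a *: x) (b *: y) = a * (b * d x y).
Proof. by rewrite (linearZl_LR d) (linearZr_LR d). Qed.

Lemma dot_CauchySchwarz x y : d x y ^+ 2 <= d x x * d y y.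
Proof.
have [->|y0] := eqVneq y 0; first by rewrite !linear0r expr0n.
have yy : 0 < d y y by exact: neq0_dnorm_gt0.
have := dot_ge0 (d y y *: x + (- d x y) *: y).
rewrite dotDD !dotZZ.
rewrite [leRHS](_ : _ = d y y * (d x x * d y y - d x y ^+ 2)); last by ring.
by rewrite pmulr_rge0// subr_ge0.
Qed.

Let nrm x := Num.sqrt (d x x).

Lemma dot_normD x y : nrm (x + y) <= nrm x + nrm y.
Proof.
rewrite -(@ler_pXn2r _ 2)// ?nnegrE ?addr_ge0 ?sqrtr_ge0//.
rewrite sqrrD !sqr_sqrtr ?dot_ge0// dotDD lerD2r lerD2l lerMn2r/=.
rewrite -sqrtrM ?dot_ge0//; apply: le_trans (ler_norm _) _.
by rewrite -sqrtr_sqr ler_wsqrtr// dot_CauchySchwarz.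
Qed.

Lemma dot_normZ a x : nrm (a *: x) = `|a| * nrm x.
Proof. by rewrite /nrm dotZZ mulrA -expr2 sqrtrM ?sqr_ge0// sqrtr_sqr. Qed.

Lemma dot_norm_eq0 x : nrm x = 0 -> x = 0.
Proof.
move=> /eqP; rewrite sqrtr_eq0 => dx; apply: dot_eq0.
by apply/eqP; rewrite eq_le dx dot_ge0.
Qed.

End DotReal.

(* An alias of {ffun 'I_m -> X}, so that the Hilbert norm sqrt(sum_i |x_i|^2)
   below is attached to hpow X m and not to finite functions in general. *)
Definition hpow (X : Type) (m : nat) : Type := {ffun 'I_m -> X}.

Section HilbertPower.
Context (R : realType) (X : hilbertType R) (m : nat).

HB.instance Definition _ := GRing.Lmodule.on (hpow X m).

Implicit Types x y : hpow X m.

Definition hpow_inner x y : R := \sum_(i < m) inner (x i) (y i).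

Lemma hpow_inner_bilinear : bilinear_for *%R (idfun \; *%R) hpow_inner.
Proof.
split=> u a x y; rewrite /hpow_inner/= mulr_sumr -big_split/=;
  apply: eq_bigr => i _.
  by rewrite !ffunE linearPl.
by rewrite !ffunE linearPr.
Qed.

HB.instance Definition _ := bilinear_isBilinear.Build R (hpow X m) (hpow X m) R
  *%R (idfun \; *%R) hpow_inner hpow_inner_bilinear.

Lemma hpow_inner_sym x y :
  hpow_inner x y = (-1) ^+ false * idfun (hpow_inner y x).
Proof.
by rewrite expr0 mul1r; apply: eq_bigr => i _; rewrite dot_sym.
Qed.

HB.instance Definition _ := isHermitianSesquilinear.Build R (hpow X m)
  false idfun hpow_inner hpow_inner_sym.

Lemma hpow_inner_gt0 x : x != 0 -> 0 < hpow_inner x x.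
Proof.
move=> x0; rewrite lt0r sumr_ge0 ?andbT => [|i _]; last exact: dot_ge0.
apply: contra x0; rewrite psumr_eq0 => [/allP xi|i _]; last exact: dot_ge0.
apply/eqP/ffunP => i; rewrite ffunE; apply: (@dot_eq0 _ _ inner).
exact/eqP/xi/mem_index_enum.
Qed.

HB.instance Definition _ := isDotProduct.Build R (hpow X m) hpow_inner
  hpow_inner_gt0.

HB.instance Definition _ := @Lmodule_isNormed.Build R (hpow X m)
  (fun x => Num.sqrt (hpow_inner x x))
  (dot_normD hpow_inner) (dot_normZ hpow_inner) (@dot_norm_eq0 _ _ hpow_inner).

Lemma hpow_innerxx x : hpow_inner x x = `|x| ^+ 2.
Proof. by rewrite sqr_sqrtr// dot_ge0. Qed.

Lemma hpow_coord_le x i : `|x i| <= `|x|.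
Proof.
rewrite -(@ler_pXn2r _ 2)// ?nnegrE// -hpow_innerxx -innerxx.
by rewrite /hpow_inner (bigD1 i)//= lerDl sumr_ge0// => j _; exact: dot_ge0.
Qed.

Lemma hpow_norm_le x (e : R) : 0 <= e -> (forall i, `|x i| <= e) ->
  `|x| <= Num.sqrt m%:R * e.
Proof.
move=> e0 xe; rewrite -(@ler_pXn2r _ 2)// ?nnegrE ?mulr_ge0 ?sqrtr_ge0//.
rewrite -hpow_innerxx exprMn sqr_sqrtr// -[X in X%:R * _]card_ord -sum1_card.
rewrite natr_sum mulr_suml; apply: ler_sum => i _.
by rewrite mul1r innerxx ler_pXn2r// nnegrE.
Qed.

Lemma hpow_complete (F : set_system (hpow X m)) :
  ProperFilter F -> cauchy F -> cvg F.
Proof.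
move=> FF Fc.
have cF i : cvg ((fun x : hpow X m => x i) @ F).
  apply: cauchy_cvg; apply/cauchyP => e e0.
  have [x Fx] := (cauchyP F).1 Fc e e0.
  exists (x i).
  apply: (@filterS _ F _ (ball x e)) Fx => y; rewrite /= -!ball_normE/=.
  by apply: le_lt_trans; have := hpow_coord_le (x - y) i; rewrite !ffunE.
pose l : hpow X m := [ffun i => lim ((fun x : hpow X m => x i) @ F)].
apply/cvg_ex; exists l; apply/cvgrPdist_le => e e0.
pose e' := e / (Num.sqrt m%:R + 1).
have e'0 : 0 < e' by rewrite divr_gt0// ltr_wpDl// sqrtr_ge0.
have : \forall x \near F, forall i, `|l i - (x : hpow X m) i| <= e'.
  apply: filter_forall => i; rewrite ffunE.
  by have /cvgrPdist_le/(_ _ e'0) := cF i.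
apply: filterS => x lx; apply: le_trans (hpow_norm_le (ltW e'0) _) _.
  by move=> i; rewrite !ffunE; have := lx i; rewrite ffunE.
by rewrite /e' mulrCA ger_pMr// ler_pdivrMr ?mul1r ?lerDl// ltr_wpDl ?sqrtr_ge0.
Qed.

HB.instance Definition _ :=
  Uniform_isComplete.Build (hpow X m) hpow_complete.

HB.instance Definition _ :=
  CompleteNormedModule_isHilbert.Build R (hpow X m) hpow_innerxx.

End HilbertPower.

Section ConvexAnalysis.
Context (R : realType) (X : hilbertType R).
Implicit Types (f g : X -> \bar R) (C : set X) (x y u : X).
Local Open Scope ereal_scope.

Definition edom f : set X := [set x | f x < +oo].

Definition proper_efun f := (forall x, -oo < f x) /\ edom f !=set0.

(* Only meant for f > -oo, where the right-hand side is never +oo - oo. *)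
Definition convex_efun f := forall (t : R) x y, (0 < t < 1)%R ->
  f (t *: x + (1 - t) *: y)%R <= t%:E * f x + (1 - t)%:E * f y.

Definition indicator C x : \bar R := if x \in C then 0 else +oo.

Definition orth C : set X := [set x | forall u, C u -> inner x u = 0%R].

Definition fenchel_conj f x := ereal_sup [set (inner u x)%:E - f u | u in setT].

Definition infconv f g x := ereal_inf [set f u + g (x - u)%R | u in setT].

Definition lsc_hull f x := ereal_sup
  [set g x | g in [set g | lower_semicontinuous g /\ forall y, g y <= f y]].

Definition subdiff f x : set X :=
  [set u | forall y, (inner (y - x) u)%:E + f x <= f y].

End ConvexAnalysis.

Section Operators.
Context (R : realType) (X : hilbertType R).
Implicit Types A B : X -> set X.

Definition op_fun (F : X -> X) : X -> set X := fun x => [set F x].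

Definition op_add A B : X -> set X := fun x => [set u + v | u in A x & v in B x].

Definition op_inv A : X -> set X := fun u => [set x | A x u].

Definition op_tilde B : X -> set X := fun u => [set - x | x in op_inv B (- u)].

Definition zeros A : set X := [set x | A x 0].

Definition monotone_op A :=
  forall x u y v, A x u -> A y v -> 0 <= inner (x - y) (u - v).

Definition maximally_monotone A := monotone_op A /\
  forall B, monotone_op B -> (forall x, A x `<=` B x) -> forall x, B x `<=` A x.

Definition attouch_thera_dual A B : X -> set X :=
  op_add (op_inv A) (op_tilde B).

(* A problem is identified with its solution set.  The dual is only defined for
   maximally monotone A and B, so their maximal monotonicity is part of the
   claim. *)
Definition is_attouch_thera_dual A B (primal dual : set X) :=
  [/\ maximally_monotone A, maximally_monotone B,
      primal = zeros (op_add A B) & dual = zeros (attouch_thera_dual A B)].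

End Operators.

Section Cycles.
Context (R : realType) (X : hilbertType R) (m : nat).
Implicit Types (x : hpow X m) (f : 'I_m -> X -> \bar R).

Definition diagonal_space : set (hpow X m) :=
  [set x | exists u, x = [ffun=> u]].

(* ord_pred is cyclic, so (x_1, ..., x_m) is sent to (x_m, x_1, ..., x_(m-1)). *)
Definition cshift x : hpow X m := [ffun i => x (ord_pred i)].

Definition cycle_op x : hpow X m := (2 * m)%:R^-1 *:
  \sum_(1 <= k < m) (m%:R - (2 * k)%:R : R) *: iter k cshift x.

Definition sep_sum f x : \bar R := (\sum_(i < m) f i (x i))%E.

Definition problemP f : set (hpow X m) :=
  zeros (op_add (subdiff (lsc_hull (infconv (sep_sum f)
                                            (indicator diagonal_space))))
                (op_fun (fun x => x - cshift x)))
  `&` orth diagonal_space.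

Definition problemD f : set (hpow X m) :=
  zeros (op_add
    (subdiff (fenchel_conj (sep_sum f) \+
              fenchel_conj (indicator diagonal_space))%E)
    (op_fun (fun y => 2^-1 *: y + cycle_op y))).

End Cycles.

(* Main.v *)
From HB Require Import structures.
Require Import Defs.
From mathcomp Require Import all_boot all_order all_algebra.
From mathcomp Require Import all_classical all_reals all_analysis.
From mathcomp Require Import zify ring lra.
Set Implicit Arguments.
Unset Strict Implicit.
Unset Printing Implicit Defensive.
Import Order.TTheory GRing.Theory Num.Theory.
Import numFieldNormedType.Exports.
Local Open Scope classical_set_scope.
Local Open Scope ring_scope.

(** Write F for the separable sum, D for the diagonal, R for the cyclic shift,
    T for [cycle_op], k for the infimal convolution of F with the indicator of
    D, and M = Id/2 + T.  Then F^* + indicator(D)^* is the conjugate k^*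
    ([fenchel_conj_infconv]), so the dual problem asks for y with -My in
    dk^*(y), and the primal one involves the subdifferential of the lower
    semicontinuous hull of k.

    Everything about k comes from one variational fact, [epi_convex_prox].  A
    minimising sequence of gamma k + |x - .|^2 / 2 is Cauchy by the
    parallelogram law, and its limit p, with slope s = (x - p) / gamma,
    describes k^* at s.  Letting x vary shows that Id + dk^* is onto, hence
    that dk^* is maximally monotone (Minty).  Letting gamma tend to 0 produces
    points close to x at which k is almost below its biconjugate, hence
    lsc_hull k = k^** ([lsc_hull_biconj]), and the subdifferentials of
    lsc_hull k and of k^* are inverse to each other ([subdiff_lsc_hull]).

    T is skew, because <R^k x, x> = <R^(m-k) x, x> while the coefficient m - 2k
    changes sign under k -> m - k.  So M is bounded linear with
    <x, Mx> = |x|^2 / 2, and a step along -M followed by a resolvent of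
    dk^* is a contraction whose fixed point is the solution of the dual problem
    ([strongly_monotone_inclusion]).

    The Attouch-Thera dual asks for x = -My with x in dk^*(y).  Summation by
    parts gives M(y - Ry) = y on the orthogonal of D ([half_add_cycleK]).
    M maps that subspace to itself and is injective, so M and Id - R are
    inverse to each other there.  Since the domain of k^* lies in the
    orthogonal of D, the equation x = -My means exactly that x is orthogonal to
    D and y = -(x - Rx), which is the primal problem.  Hence y -> -My is a
    bijection between the solutions of the two problems. *)

(** * Inner product calculus *)

Section InnerProduct.
Context (R : realType) (X : hilbertType R).
Implicit Types x y z : X.

Lemma innerC x y : inner x y = inner y x. Proof. exact: dot_sym. Qed.

Lemma innerDl x y z : inner (x + y) z = inner x z + inner y z.
Proof. exact: linearDl. Qed.

Lemma innerDr x y z : inner x (y + z) = inner x y + inner x z.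
Proof. exact: linearDr. Qed.

Lemma innerZl a x y : inner (a *: x) y = a * inner x y.
Proof. exact: linearZl_LR. Qed.

Lemma innerZr a x y : inner x (a *: y) = a * inner x y.
Proof. exact: linearZr_LR. Qed.

Lemma innerNl x y : inner (- x) y = - inner x y.
Proof. by rewrite -scaleN1r innerZl mulN1r. Qed.

Lemma innerNr x y : inner x (- y) = - inner x y.
Proof. by rewrite -scaleN1r innerZr mulN1r. Qed.

Lemma inner0l x : inner 0 x = 0.
Proof. by rewrite -(scale0r (0 : X)) innerZl mul0r. Qed.

Lemma inner0r x : inner x 0 = 0. Proof. by rewrite innerC inner0l. Qed.

Definition innerE := (innerDl, innerDr, innerNl, innerNr, innerZl, innerZr).

Lemma inner_ge0 x : 0 <= inner x x. Proof. exact: dot_ge0. Qed.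

Lemma inner_eq0 x : inner x x = 0 -> x = 0. Proof. exact: dot_eq0. Qed.

Lemma inner_ext x y : (forall u, inner x u = inner y u) -> x = y.
Proof.
move=> xy; apply/subr0_eq/inner_eq0.
by rewrite innerDl innerNl xy subrr.
Qed.

Lemma inner_le_norm x y : inner x y <= `|x| * `|y|.
Proof.
rewrite (le_trans (ler_norm _))// -(@ler_pXn2r _ 2)// ?nnegrE ?mulr_ge0//.
by rewrite real_normK ?num_real// exprMn -!innerxx; exact: dot_CauchySchwarz.
Qed.

End InnerProduct.

(** * Proximal points of convex functions *)

Section ProximalPoint.
Context (R : realType) (X : hilbertType R).
Implicit Types (k : X -> \bar R) (x y s p v w : X) (a b c e t : R).

(** Convexity of the strict epigraph.  Unlike [convex_efun], it makes sense for
    functions that take the value -oo, and it passes through infima. *)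
Definition epi_convex k := forall t x y a b, 0 < t < 1 ->
  (k x < a%:E)%E -> (k y < b%:E)%E ->
  (k (t *: x + (1 - t) *: y)%R < (t * a + (1 - t) * b)%R%:E)%E.

Lemma edom_lt k x : edom k x -> exists a, (k x < a%:E)%E.
Proof.
rewrite /edom/=; case: (k x) => [r| |]// _.
  by exists (r + 1); rewrite lte_fin ltrDl.
by exists 0; rewrite ltNyr.
Qed.

Lemma fenchel_conj_ge k x a v :
  (k x < a%:E)%E -> ((inner x v - a)%R%:E <= fenchel_conj k v)%E.
Proof.
move=> kxa; apply: le_ereal_sup_tmp; exists ((inner x v)%:E - k x)%E.
  by exists x.
case: (k x) kxa => [r| |]//= kxa; last by rewrite leey.
by rewrite -EFinB lee_fin lerB// ltW.
Qed.

Lemma fenchel_conj_le k v c :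
  (forall x a, (k x < a%:E)%E -> inner x v - a <= c) ->
  (fenchel_conj k v <= c%:E)%E.
Proof.
move=> h; apply/ereal_supP => _ [x _ <-].
move: (h x); case: (k x) => [r| |] hx.
- rewrite -EFinB lee_fin lerBlDr; apply/ler_addgt0Pr => e e0.
  by have := hx (r + e); rewrite lte_fin ltrDl => /(_ e0); lra.
- by rewrite leNye.
- have := hx (inner x v - c - 1); rewrite ltNyr => /(_ isT) ?; exfalso; lra.
Qed.

Lemma ge0_of_linear_perturbation (A B : R) :
  0 <= B -> (forall t, 0 < t < 1 -> 0 <= A + t * B) -> 0 <= A.
Proof.
move=> B0 h; rewrite leNgt; apply/negP => A0.
have D0 : 0 < 1 + B - A by lra.
(* This t gives A + t B = - t (1 - A). *)
pose t := - A / (1 + B - A).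
have tD : t * (1 + B - A) = - A by rewrite divfK// gt_eqF.
have t0 : 0 < t by rewrite divr_gt0// oppr_gt0.
have t1 : t < 1 by rewrite ltr_pdivrMr// mul1r; lra.
by have := h t; rewrite t0 t1 => /(_ isT); nra.
Qed.

(** The point p is the proximal point of the closure of k, and e the value
    there of that closure; both are limits along a minimising sequence of
    gamma k + |x - .|^2 / 2 over the strict epigraph.  Optimality of p gives
    k an affine minorant of slope s that takes the value e at p, which is the
    upper bound on the conjugate at s. *)
Lemma epi_convex_prox k (gamma : R) x :
  epi_convex k -> edom k !=set0 -> edom (fenchel_conj k) !=set0 -> 0 < gamma ->
  exists s p e, [/\ p = x - gamma *: s,
      (fenchel_conj k s <= (inner p s - e)%R%:E)%E,
      forall v, ((inner p v - e)%R%:E <= fenchel_conj k v)%E &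
      forall eps : R, 0 < eps ->
        exists2 y, `|y - p| < eps & (k y < (e + eps)%R%:E)%E].
Proof.
move=> kcvx [x0 kx0] [w kw] gamma0.
pose E := [set z : X * R | (k z.1 < z.2%:E)%E].
pose q (z : X * R) := gamma * z.2 + 2^-1 * `|x - z.1| ^+ 2.
have [a0 kxa0] := edom_lt kx0; have [c /ltW kwc] := edom_lt kw.
have Ew z : E z -> inner z.1 w - z.2 <= c.
  by move=> Ez; rewrite -lee_fin (le_trans (fenchel_conj_ge w Ez)).
have hS : has_inf [set q z | z in E].
  split; first by exists (q (x0, a0)); exists (x0, a0).
  (* Complete the square in x - y - gamma w. *)
  exists (gamma * (inner x w - c) - 2^-1 * gamma ^+ 2 * inner w w).
  move=> _ [z Ez <-]; have := Ew _ Ez.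
  have := inner_ge0 (x - z.1 - gamma *: w).
  rewrite /q -innerxx !innerE (innerC z.1 x) (innerC w x) (innerC w z.1) => h1 h2.
  have : gamma * (inner z.1 w - z.2) <= gamma * c by rewrite ler_pM2l.
  by move: h1; set A := inner x x; set B := inner x z.1; lra.
set I := inf [set q z | z in E].
have qI z : E z -> I <= q z by move=> Ez; apply: ge_inf hS.2 _ _; exists z.
have /choice[u hu] n : exists z, E z /\ q z < I + harmonic n.
  have [_ [z Ez <-] ?] := @inf_adherent _ _ (harmonic n : R) (harmonic_gt0 n) hS.
  by exists z.
pose y n := (u n).1; pose a n := (u n).2.
(* Parallelogram law, as the midpoint of two epigraph points is one too. *)
have ydist n j : `|y n - y j| ^+ 2 <= 4 * (harmonic n + harmonic j).
  have [En qn] := hu n; have [Ej qj] := hu j.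
  have h2 : 0 < (2^-1 : R) < 1.
    by apply/andP; split; lra.
  have := qI (_, _) (kcvx _ _ _ _ _ h2 En Ej).
  move: qn qj; rewrite /q; move: (harmonic n) (harmonic j) => hn hj /=.
  rewrite -/(y n) -/(y j) -/(a n) -/(a j).
  rewrite -!innerxx !innerE (innerC (y j) (y n)) (innerC (y j) x) (innerC (y n) x).
  by lra.
have h_to0 : harmonic n @[n --> \oo] --> (0 : R) by exact: cvg_harmonic.
have yc : cvgn y.
  apply: cauchy_cvg; apply/cauchyP => e e0.
  have e8 : 0 < e ^+ 2 / 8 by rewrite divr_gt0 ?exprn_gt0.
  have [N _ hN] := cvgr_lt (0 : R) h_to0 _ e8.
  exists (y N), N => // n Nn; rewrite -ball_normE/=.
  rewrite -(@ltr_pXn2r _ 2)// ?nnegrE ?(ltW e0)//; apply: le_lt_trans (ydist _ _) _.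
  have hN' i : (N <= i)%N -> harmonic i < e ^+ 2 / 8 by exact: hN.
  have := hN' _ Nn; have := hN' _ (leqnn N).
  by move: (harmonic N) (harmonic n) => h1 h2; lra.
pose p := limn y.
have yp : y n @[n --> \oo] --> p by exact: yc.
pose e := gamma^-1 * (I - 2^-1 * `|x - p| ^+ 2).
have Ie : I = gamma * e + 2^-1 * `|x - p| ^+ 2.
  by rewrite /e mulVKf ?gt_eqF// subrK.
have qnI : q (u n) @[n --> \oo] --> I.
  apply: (@squeeze_cvgr _ _ _ _ (fun=> I) (fun n => I + harmonic n)).
  - by apply: nearW => n; have [/qI -> /ltW ->] := hu n.
  - exact: cvg_cst.
  - by rewrite -[X in _ --> X]addr0; apply: cvgD h_to0; exact: cvg_cst.
have nrm2 (z : nat -> X) l : z n @[n --> \oo] --> l ->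
    `|x - z n| ^+ 2 @[n --> \oo] --> `|x - l| ^+ 2.
  move=> zl; rewrite expr2; under eq_cvg do rewrite expr2.
  by apply: cvgM; apply: cvg_norm; apply: cvgB zl; exact: cvg_cst.
have ae : a n @[n --> \oo] --> e.
  have -> : a = fun n => gamma^-1 * (q (u n) - 2^-1 * `|x - y n| ^+ 2).
    by apply/funext => n; rewrite /q addrK mulKf ?gt_eqF.
  apply: cvgM; first exact: cvg_cst.
  apply: cvgB => //; apply: cvgM; first exact: cvg_cst.
  exact: nrm2.
(* First-order optimality of p, tested on the segment from p to z. *)
have key z b : (k z < b%:E)%E -> inner (x - p) (z - p) <= gamma * (b - e).
  move=> Ez; rewrite -subr_ge0.
  apply: (@ge0_of_linear_perturbation _ (2^-1 * `|z - p| ^+ 2)).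
    by rewrite mulr_ge0 ?sqr_ge0.
  move=> t t01.
  suff : I <= gamma * (t * b + (1 - t) * e)
      + 2^-1 * `|x - (t *: z + (1 - t) *: p)| ^+ 2.
    have t0 : 0 < t by case/andP: t01.
    rewrite Ie -!innerxx !innerE (innerC p x) (innerC p z) (innerC z x) => h.
    rewrite -(pmulr_rge0 _ t0); move: h; move: (inner _ _) (inner _ _) (inner _ _).
    by move=> *; lra.
  apply: (@cvgr_to_ge _ \oo _ _
    (fun n => gamma * (t * b + (1 - t) * a n)
      + 2^-1 * `|x - (t *: z + (1 - t) *: y n)| ^+ 2)).
    apply: cvgD; apply: cvgM; try exact: cvg_cst.
      apply: cvgD; first exact: cvg_cst.
      by apply: cvgM => //; exact: cvg_cst.
    apply: nrm2; apply: cvgD; first exact: cvg_cst.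
    exact: cvgZl_tmp.
  apply: nearW => n; have [En _] := hu n.
  exact: qI (_, _) (kcvx _ _ _ _ _ t01 Ez En).
have pE : p = x - gamma *: (gamma^-1 *: (x - p)).
  by rewrite scalerA divff ?gt_eqF// scale1r opprB addrC subrK.
have near_p (eps : R) : 0 < eps ->
    exists2 z, `|z - p| < eps & (k z < (e + eps)%R%:E)%E.
  move=> eps0.
  have /cvgrPdist_lt/(_ _ eps0)[N1 _ h1] := yp.
  have [|N2 _ h2] := cvgr_lt e ae (e + eps); first by rewrite ltrDl.
  exists (y (maxn N1 N2)).
    by rewrite distrC; apply: h1 => /=; rewrite leq_maxl.
  have [En _] := hu (maxn N1 N2); apply: lt_trans En _.
  by rewrite lte_fin; apply: h2 => /=; rewrite leq_maxr.
exists (gamma^-1 *: (x - p)), p, e; split=> //.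
- apply: fenchel_conj_le => z b /key; rewrite -(@ler_pM2l _ gamma^-1) ?invr_gt0//.
  by rewrite mulKf ?gt_eqF// !innerE (innerC z x) (innerC p x) (innerC p z); lra.
- move=> v; apply/lee_addgt0Pr => eps eps0; rewrite -leeBlDr// -EFinB.
  have d0 : 0 < 1 + `|v| by rewrite ltr_pwDl.
  have [z zp /(fenchel_conj_ge v)] := near_p _ (divr_gt0 eps0 d0).
  apply: le_trans; rewrite lee_fin.
  have := inner_le_norm (p - z) v; rewrite !innerE distrC.
  have : `|z - p| * `|v| <= eps / (1 + `|v|) * `|v| by rewrite ler_wpM2r// ltW.
  have : eps / (1 + `|v|) * (1 + `|v|) = eps by rewrite divfK// gt_eqF.
  lra.
Qed.

End ProximalPoint.

(** * Conjugates, subdifferentials and maximal monotonicity *)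

Section ConjugateSubdifferential.
Context (R : realType) (X : hilbertType R).
Implicit Types (f g k : X -> \bar R) (x y s u v w : X).

Lemma fenchel_conj_gtNy k v : edom k !=set0 -> (-oo < fenchel_conj k v)%E.
Proof.
move=> [x /edom_lt[a /(fenchel_conj_ge v)]].
by apply: lt_le_trans; rewrite ltNyr.
Qed.

Lemma fenchel_young f x v : ((inner x v)%:E - f x <= fenchel_conj f v)%E.
Proof. by apply: le_ereal_sup_tmp; exists ((inner x v)%:E - f x)%E => //; exists x. Qed.

Lemma proper_fenchel_conj k : edom k !=set0 -> edom (fenchel_conj k) !=set0 ->
  proper_efun (fenchel_conj k).
Proof. by move=> k0 k'0; split=> // x; exact: fenchel_conj_gtNy. Qed.

Lemma proper_edom_fin g x : proper_efun g -> edom g x -> exists r : R, g x = r%:E.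
Proof.
move=> [gNy _]; rewrite /edom/=; have := gNy x.
by case: (g x) => [r| |]// _ _; exists r.
Qed.

Lemma subdiff_edom g x u : proper_efun g -> subdiff g x u -> edom g x.
Proof.
move=> gp xu; have [gNy [y gy]] := gp; have [r gyr] := proper_edom_fin gp gy.
have := xu y; have := gNy x; rewrite gyr /edom/=.
by case: (g x) => [a| |]//; rewrite ltry.
Qed.

Lemma subdiff_monotone g : proper_efun g -> monotone_op (subdiff g).
Proof.
move=> gp x u y v xu yv.
have [a xa] := proper_edom_fin gp (subdiff_edom gp xu).
have [b yb] := proper_edom_fin gp (subdiff_edom gp yv).
have := xu y; have := yv x; rewrite xa yb -!EFinD !lee_fin !innerE.
by lra.
Qed.

(** Minty's criterion: if x + u = y + v with v in A y, monotonicity of an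
    extension of A containing (x, u) forces -|x - y|^2 >= 0. *)
Lemma maximally_monotone_minty (A : X -> set X) : monotone_op A ->
  (forall z, exists y, A y (z - y)) -> maximally_monotone A.
Proof.
move=> mA sA; split=> // B mB AB x u Bxu.
have [y Ay] := sA (x + u).
have := mB _ _ _ _ Bxu (AB _ _ Ay).
have -> : u - (x + u - y) = - (x - y) by rewrite !opprB [x + u]addrC addrCA opprD addNKr.
rewrite innerNr oppr_ge0 => xy0.
have /inner_eq0/subr0_eq xy : inner (x - y) (x - y) = 0.
  by apply/eqP; rewrite eq_le xy0 inner_ge0.
by move: Ay; rewrite -xy addrAC subrr add0r.
Qed.

Section Conjugate.
Context (k : X -> \bar R).
Context (kcvx : epi_convex k) (k_dom : edom k !=set0)
  (conj_dom : edom (fenchel_conj k) !=set0).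

(** The resolvent of the subdifferential of k^* is everywhere defined: by
    Moreau's decomposition it sends x to the slope at the proximal point. *)
Lemma subdiff_conj_resolvent (gamma : R) x : 0 < gamma ->
  exists s, subdiff (fenchel_conj k) s (x - gamma *: s).
Proof.
move=> gamma0; have [s [p [e [pE ks kge _]]]] := epi_convex_prox x kcvx k_dom conj_dom gamma0.
exists s => v; rewrite -pE; apply: le_trans (kge v).
rewrite [(inner p v - e)%R](_ : _ = inner (v - s) p + (inner p s - e)); last first.
  by rewrite !innerE (innerC v p) (innerC s p); lra.
by rewrite EFinD leeD2l.
Qed.

Lemma subdiff_conj_maximally_monotone :
  maximally_monotone (subdiff (fenchel_conj k)).
Proof.
apply: maximally_monotone_minty => [|z].
  exact: subdiff_monotone (proper_fenchel_conj k_dom conj_dom).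
by have [s] := subdiff_conj_resolvent z ltr01; rewrite scale1r; exists s.
Qed.

Lemma biconj_le x : (fenchel_conj (fenchel_conj k) x <= k x)%E.
Proof.
apply/ereal_supP => _ [u _ <-].
have kugt := fenchel_conj_gtNy u k_dom; have := fenchel_young k x u.
case: (fenchel_conj k u) kugt => [r| |]// _; last by rewrite addeNy leNye.
case: (k x) => [b| |]//=; last by rewrite leey.
by rewrite -!EFinB !lee_fin innerC; lra.
Qed.

Lemma fenchel_conj_lsc (g : X -> \bar R) : lower_semicontinuous (fenchel_conj g).
Proof.
move=> x a /ereal_sup_gt[_ [u _ <-]] gu.
case gE : (g u) gu => [r| |]//=; last first.
  move=> _; exists setT; first exact: filterT.
  move=> y _; apply: lt_le_trans (fenchel_young g u y).
  by rewrite gE ltry.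
rewrite -EFinB lte_fin => aur.
pose d := (inner u x - r - a) / (1 + `|u|).
have u0 : 0 < 1 + `|u| by rewrite ltr_pwDl.
have d0 : 0 < d by rewrite divr_gt0//; lra.
exists (ball x d); first exact: nbhsx_ballx.
move=> y; rewrite -ball_normE/= => xy.
apply: lt_le_trans (fenchel_young g u y); rewrite gE -EFinB lte_fin.
have := inner_le_norm (x - y) u; rewrite !innerE (innerC x) (innerC y).
have : `|x - y| * `|u| <= d * `|u| by rewrite ler_wpM2r// ltW.
have : d * (1 + `|u|) = inner u x - r - a by rewrite divfK// gt_eqF.
by lra.
Qed.

(** If g x exceeded k^**(x), then on a ball around x both g and k would stay
    above some level greater than k^**(x).  For small gamma the proximal point
    of x lies in this ball, because the affine minorant provided by the domain
    of k^* bounds gamma |s|^2 independently of gamma.  But arbitrarily close to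
    the proximal point k takes values below that level. *)
Lemma lsc_le_biconj g x : lower_semicontinuous g -> (forall y, (g y <= k y)%E) ->
  (g x <= fenchel_conj (fenchel_conj k) x)%E.
Proof.
move=> glsc gk; rewrite leNgt; apply/negP => gx.
have [w kw] := conj_dom.
have [c wc] := proper_edom_fin (proper_fenchel_conj k_dom conj_dom) kw.
have [r rE] : exists r, fenchel_conj (fenchel_conj k) x = r%:E.
  have := fenchel_young (fenchel_conj k) w x; rewrite wc.
  case: (fenchel_conj (fenchel_conj k) x) gx => [r _ _|+ _|//]; first by exists r.
  by rewrite ltNge leey.
have [a ra ag] : exists2 a, r < a & (a%:E < g x)%E.
  move: gx; rewrite rE; case: (g x) => [b| |]//; last first.
    by exists (r + 1); rewrite ?ltrDl// ltry.
  rewrite lte_fin => rb; exists (2^-1 * (r + b)); first by lra.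
  by rewrite lte_fin; lra.
have [V /nbhs_ballP[d /= d0 dV] gV] := glsc x a ag.
(* D will bound gamma |s|^2, and gamma is chosen so that gamma D < d^2. *)
pose D := 2 * (r - inner x w + c) + inner w w.
pose gamma := d ^+ 2 / (`|D| + 1 + d ^+ 2).
have den0 : 0 < `|D| + 1 + d ^+ 2 by rewrite ltr_wpDr ?sqr_ge0// ltr_wpDl.
have gamma0 : 0 < gamma by rewrite divr_gt0// exprn_gt0.
have gammaE : gamma * (`|D| + 1 + d ^+ 2) = d ^+ 2 by rewrite divfK// gt_eqF.
have [s [p [e [pE ks kge near_p]]]] :=
  epi_convex_prox x kcvx k_dom conj_dom gamma0.
have xp : x - p = gamma *: s by rewrite pE opprB addrC subrK.
have se : gamma * inner s s + e <= r.
  rewrite -lee_fin -rE; apply: le_trans (fenchel_young _ s x).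
  apply: (@le_trans _ _ ((inner s x)%:E - (inner p s - e)%R%:E)%E).
    by rewrite -EFinB lee_fin pE !innerE (innerC x s); lra.
  by apply: leeB.
have ew : inner p w - e <= c.
  by rewrite -lee_fin -wc; exact: kge.
have ss : gamma * inner s s <= D.
  have := inner_ge0 (s - w); move: ew; rewrite pE !innerE (innerC w s) /D => ew.
  have : gamma <= 1 by rewrite ler_pdivrMr// mul1r; have := normr_ge0 D; lra.
  have := inner_ge0 w.
  nra.
have xpd : `|x - p| < d.
  rewrite -(@ltr_pXn2r _ 2)// ?nnegrE ?(ltW d0)// xp -innerxx !innerE.
  have := ler_norm D; have : 0 < d ^+ 2 by rewrite exprn_gt0.
  nra.
have [y yp ky] : exists2 y, `|y - p| < d - `|x - p| & (k y < a%:E)%E.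
  have [|y yp ky] := near_p (Num.min (d - `|x - p|) (a - e)).
    rewrite lt_min !subr_gt0 xpd /=; apply: le_lt_trans ra.
    by have := inner_ge0 s; nra.
  exists y; first by apply: lt_le_trans yp _; rewrite ge_min lexx.
  apply: lt_le_trans ky _; rewrite lee_fin -lerBrDl.
  by rewrite ge_min lexx orbT.
have /gV : V y.
  apply: dV; rewrite -ball_normE/=.
  by rewrite (le_lt_trans (ler_distD p _ _))// (distrC p y); lra.
by rewrite ltNge (le_trans (gk y))// ltW.
Qed.

Theorem lsc_hull_biconj : lsc_hull k = fenchel_conj (fenchel_conj k).
Proof.
apply/funext => x; apply/eqP; rewrite eq_le; apply/andP; split.
  by apply/ereal_supP => _ [g [glsc gk] <-]; exact: lsc_le_biconj.
apply: le_ereal_sup_tmp; exists (fenchel_conj (fenchel_conj k) x) => //.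
exists (fenchel_conj (fenchel_conj k)) => //; split; first exact: fenchel_conj_lsc.
exact: biconj_le.
Qed.

(** Both inclusions express equality in the Fenchel-Young inequality between
    k^* and k^** = lsc_hull k. *)
Theorem subdiff_lsc_hull x u :
  subdiff (lsc_hull k) x u <-> subdiff (fenchel_conj k) u x.
Proof.
rewrite lsc_hull_biconj; set g := fenchel_conj k.
have gp : proper_efun g by exact: proper_fenchel_conj.
have hp : proper_efun (fenchel_conj g).
  split=> [y|]; first by exact: fenchel_conj_gtNy.
  have [y ky] := k_dom; exists y; exact: le_lt_trans (biconj_le y) ky.
split=> [xu|ux].
- have [a ha] := proper_edom_fin hp (subdiff_edom hp xu).
  have gu : (g u <= (inner x u - a)%R%:E)%E.
    apply: fenchel_conj_le => y b kyb.
    have := le_trans (xu y) (le_trans (biconj_le y) (ltW kyb)).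
    by rewrite ha -EFinD lee_fin !innerE; lra.
  move=> v; have := fenchel_young g v x; rewrite ha.
  case: (g v) (gp.1 v) => [b| |]// _; last by rewrite leey.
  rewrite -EFinB lee_fin => bva.
  apply: (@le_trans _ _ ((inner (v - u) x)%:E + (inner x u - a)%R%:E)%E).
    by rewrite leeD2l.
  by rewrite -EFinD lee_fin !innerE (innerC u x); lra.
- have [b gb] := proper_edom_fin gp (subdiff_edom gp ux).
  have hx : (fenchel_conj g x <= (inner u x - b)%R%:E)%E.
    apply: fenchel_conj_le => v c gvc.
    have := le_trans (ux v) (ltW gvc).
    by rewrite gb -EFinD lee_fin !innerE; lra.
  move=> y; apply: le_trans (fenchel_young g u y).
  apply: (@le_trans _ _ ((inner (y - x) u)%:E + (inner u x - b)%R%:E)%E).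
    by rewrite leeD2l.
  by rewrite gb -!EFinB -EFinD lee_fin !innerE (innerC u x) (innerC u y); lra.
Qed.

End Conjugate.

End ConjugateSubdifferential.

(** * Infimal convolutions, indicators and separable sums *)

Section InfimalConvolution.
Context (R : realType) (X : hilbertType R).
Implicit Types (f g : X -> \bar R) (C : set X) (x y u v : X).

Lemma convex_epi_convex f : (forall x, -oo < f x)%E -> convex_efun f ->
  epi_convex f.
Proof.
move=> fNy fcvx t x y a b t01 fxa fyb; apply: le_lt_trans (fcvx t x y t01) _.
have /andP[t0 t1] := t01.
case: (f x) (fNy x) fxa => [r| |]// _; case: (f y) (fNy y) fyb => [s| |]// _.
rewrite -!EFinM -EFinD !lte_fin => sb ra.
by rewrite ltrD// ltr_pM2l// subr_gt0.
Qed.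

Section Infconv.
Context (f g : X -> \bar R).
Context (f_proper : proper_efun f) (g_proper : proper_efun g).

(** The strict epigraph of an infimal convolution is the sum of the strict
    epigraphs, even when the infimum is not attained. *)
Lemma infconv_ltP x (a : R) : (infconv f g x < a%:E)%E <->
  exists u b c, [/\ (f u < b%:E)%E, (g (x - u)%R < c%:E)%E & a = b + c].
Proof.
split=> [/ereal_inf_lt[_ [u _ <-]]|[u [b [c [fub gc ->]]]]].
  case fu : (f u) (f_proper.1 u) => [r| |]// _;
    case gu : (g (x - u)) (g_proper.1 (x - u)) => [s| |]// _.
  rewrite -EFinD lte_fin => rsa; pose d := 2^-1 * (a - (r + s)).
  by exists u, (r + d), (s + d); rewrite fu gu !lte_fin /d; split; lra.
apply/ereal_inf_ltP; exists (f u + g (x - u)%R)%E; first by exists u.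
case: (f u) fub (f_proper.1 u) => [r| |]//;
  case: (g (x - u)) gc (g_proper.1 (x - u)) => [s| |]//.
by rewrite -EFinD !lte_fin => sc _ rb _; rewrite ltrD.
Qed.

Lemma epi_convex_infconv : epi_convex f -> epi_convex g ->
  epi_convex (infconv f g).
Proof.
move=> fcvx gcvx t x y a a' t01 /infconv_ltP[u [b [c [fub gc aE]]]].
move=> /infconv_ltP[v [b' [c' [fvb gc' a'E]]]].
apply/infconv_ltP; exists (t *: u + (1 - t) *: v).
exists (t * b + (1 - t) * b'), (t * c + (1 - t) * c'); split; last by rewrite aE a'E; ring.
  exact: fcvx.
rewrite opprD addrACA -!scalerN -!scalerDr; exact: gcvx.
Qed.

Lemma infconv_edom : edom (infconv f g) !=set0.
Proof.
have [u /edom_lt[a fua]] := f_proper.2; have [v /edom_lt[b gvb]] := g_proper.2.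
exists (u + v); apply: (@lt_trans _ _ (a + b)%R%:E); last by rewrite ltry.
by apply/infconv_ltP; exists u, a, b; rewrite addrAC subrr add0r.
Qed.

Lemma fenchel_conj_infconv v :
  fenchel_conj (infconv f g) v = (fenchel_conj f v + fenchel_conj g v)%E.
Proof.
have fNy := fenchel_conj_gtNy v f_proper.2.
have gNy := fenchel_conj_gtNy v g_proper.2.
apply/eqP; rewrite eq_le; apply/andP; split.
  case f'v : (fenchel_conj f v) fNy => [r| |]// _;
    case g'v : (fenchel_conj g v) gNy => [s| |]// _; try by rewrite ?leey.
  rewrite -EFinD; apply: fenchel_conj_le => x _ /infconv_ltP[u [b [c [fub gc ->]]]].
  move: (fenchel_conj_ge v fub) (fenchel_conj_ge v gc).
  by rewrite f'v g'v !lee_fin !innerE; lra.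
have : (-oo < fenchel_conj (infconv f g) v)%E.
  exact: fenchel_conj_gtNy infconv_edom.
case kv : (fenchel_conj (infconv f g) v) => [r| |]// _; last by rewrite leey.
have g'v u b : (f u < b%:E)%E ->
    (fenchel_conj g v <= (r - (inner u v - b))%R%:E)%E.
  move=> fub; apply: fenchel_conj_le => y c gyc.
  have : (infconv f g (u + y)%R < (b + c)%R%:E)%E.
    by apply/infconv_ltP; exists u, b, c; rewrite addrAC subrr add0r.
  by move/(fenchel_conj_ge v); rewrite kv lee_fin !innerE; lra.
have [u0 /edom_lt[a0 fu0]] := f_proper.2.
have := g'v _ _ fu0.
case g's : (fenchel_conj g v) gNy g'v => [s| |]// _ g'v _.
rewrite -leeBrDr// -EFinB; apply: fenchel_conj_le => u b /g'v.
by rewrite lee_fin; lra.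
Qed.

End Infconv.

Lemma indicator_lt C x (a : R) : (indicator C x < a%:E)%E <-> C x /\ 0 < a.
Proof.
rewrite /indicator; case: ifPn => [/set_mem Cx|/negP Cx].
  by rewrite lte_fin; split=> [|[]].
by split=> // -[/mem_set].
Qed.

Lemma proper_indicator C : C !=set0 -> proper_efun (@indicator R X C).
Proof.
move=> [x Cx]; split=> [y|]; first by rewrite /indicator; case: ifP.
by exists x; rewrite /edom/= /indicator mem_set.
Qed.

Lemma epi_convex_indicator C :
  (forall (t : R) x y, C x -> C y -> C (t *: x + (1 - t) *: y)) ->
  epi_convex (@indicator R X C).
Proof.
move=> Ccvx t x y a b /andP[t0 t1] /indicator_lt[Cx a0] /indicator_lt[Cy b0].
apply/indicator_lt; split; first exact: Ccvx.
by rewrite addr_gt0// mulr_gt0// subr_gt0.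
Qed.

Lemma fenchel_conj_indicator_orth C v : orth C v ->
  (fenchel_conj (@indicator R X C) v <= 0)%E.
Proof.
move=> vC; apply: fenchel_conj_le => x a /indicator_lt[Cx a0].
by rewrite innerC vC// sub0r oppr_le0 ltW.
Qed.

(** A bound on t <u, v> that holds for all real t forces <u, v> = 0. *)
Lemma fenchel_conj_indicator_edom C v :
  (forall (t : R) x, C x -> C (t *: x)) ->
  edom (fenchel_conj (@indicator R X C)) v -> orth C v.
Proof.
move=> CZ /edom_lt[c /ltW vc] u Cu.
have h (t : R) : t * inner v u <= c + 1.
  have : (@indicator R X C (t *: u)%R < 1%:E)%E by apply/indicator_lt; split=> //; exact: CZ.
  move=> /(fenchel_conj_ge v) /le_trans /(_ vc).
  by rewrite lee_fin innerZl innerC; lra.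
apply: contrapT => /eqP vu0.
by have := h ((c + 2) / inner v u); rewrite divfK//; lra.
Qed.

End InfimalConvolution.

Section SeparableSum.
Context (R : realType) (X : hilbertType R) (m : nat) (f : 'I_m -> X -> \bar R).
Context (f_proper : forall i, proper_efun (f i)).

Lemma proper_sep_sum : proper_efun (sep_sum f).
Proof.
split=> [x|].
  rewrite ltNye; apply/eqP => /eqP; rewrite esum_eqNy => /existsP[i /andP[_]].
  by have := (f_proper i).1 (x i); rewrite ltNye => /negbTE ->.
have /choice[x fx] i : exists x, edom (f i) x by have [_] := f_proper i.
exists [ffun i => x i]; rewrite /edom/= ltey; apply/eqP => /eqP.
rewrite esum_eqy => [/existsP[i /andP[_]]|i _].
  by rewrite ffunE; have := fx i; rewrite /edom/= ltey => /negbTE ->.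
by rewrite -ltNye; exact: (f_proper i).1.
Qed.

Lemma convex_sep_sum : (forall i, convex_efun (f i)) -> convex_efun (sep_sum f).
Proof.
move=> fcvx t x y t01; have /andP[t0 t1] := t01.
have fNy i z : (-oo < f i z)%E by exact: (f_proper i).1.
have scale (s : R) z : 0 < s ->
    (s%:E * sep_sum f z = \sum_(i < m) s%:E * f i (z i))%E.
  move=> s0; rewrite fin_num_sume_distrr// => i j _ _.
  by move: (fNy i (z i)) (fNy j (z j)); case: (f i _) => [a| |]; case: (f j _).
rewrite !scale ?subr_gt0// /sep_sum -big_split/=.
by apply: lee_sum => i _; rewrite !ffunE; exact: fcvx.
Qed.

End SeparableSum.

(** * Strongly monotone perturbations *)

Section StronglyMonotoneInclusion.
Context (R : realType) (X : hilbertType R).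
Implicit Types (A : X -> set X) (M : X -> X) (x y s : X).

Lemma contractive_fixed_point (Phi : X -> X) (r : R) : 0 <= r < 1 ->
  (forall x y, inner (Phi x - Phi y) (Phi x - Phi y) <= r * inner (x - y) (x - y)) ->
  exists x, x = Phi x.
Proof.
move=> /andP[r0 r1] PhiC.
pose F : {fun [set: X] >-> [set: X]} := [fun of totalfun Phi].
have FC : is_contraction F.
  exists (NngNum (sqrtr_ge0 r)); split=> /=.
    by rewrite -sqrtr1 ltr_sqrt.
  move=> -[x y] _ /=.
  rewrite -(@ler_pXn2r _ 2)// ?nnegrE ?mulr_ge0 ?sqrtr_ge0//.
  by rewrite exprMn sqr_sqrtr// -!innerxx.
have [x _ xF] := banach_fixed_point FC closedT (ex_intro _ 0 I).
by exists x.
Qed.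

(** Solutions are the fixed points of the forward-backward map, which sends y
    to the s with A s (gamma y - M y - gamma s).  For gamma = K / c, where
    K >= c^2 and M is Lipschitz with constant sqrt K, the forward step divided
    by gamma shrinks squared distances by the factor
    1 - 2c/gamma + K/gamma^2 = 1 - c/gamma, and the resolvent does not expand
    them. *)
Theorem strongly_monotone_inclusion A M (c L : R) : 0 < c ->
  (forall x y, c * inner (x - y) (x - y) <= inner (x - y) (M x - M y)) ->
  (forall x y, inner (M x - M y) (M x - M y) <= L * inner (x - y) (x - y)) ->
  monotone_op A ->
  (forall (gamma : R) x, 0 < gamma -> exists s, A s (x - gamma *: s)) ->
  exists! y, A y (- M y).
Proof.
move=> c0 Mc ML mA rA.
pose K := `|L| + c ^+ 2.
have K0 : 0 < K by rewrite ltr_wpDl// exprn_gt0.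
have MK x y : inner (M x - M y) (M x - M y) <= K * inner (x - y) (x - y).
  apply: le_trans (ML x y) _; rewrite ler_wpM2r ?inner_ge0//.
  by rewrite (le_trans (ler_norm L))// lerDl sqr_ge0.
pose gamma := K / c.
have gamma0 : 0 < gamma by rewrite divr_gt0.
have gammaE : gamma * c = K by rewrite divfK// gt_eqF.
have /choice[Phi PhiA] y : exists s, A s ((gamma *: y - M y) - gamma *: s).
  exact: rA.
(* From |w - gamma d|^2 >= 0. *)
have resolvent_le d w : 0 <= inner d (w - gamma *: d) ->
    gamma ^+ 2 * inner d d <= inner w w.
  by have := inner_ge0 (w - gamma *: d); rewrite !innerE (innerC w d); nra.
have [y yPhi] : exists y, y = Phi y.
  apply: (@contractive_fixed_point _ (1 - c / gamma)).
    rewrite subr_ge0 ltrBlDr ltrDl divr_gt0// andbT ler_pdivrMr// mul1r.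
    rewrite ler_pdivlMr// -expr2 lerDr//.
  move=> x y; have := mA _ _ _ _ (PhiA x) (PhiA y).
  set d := Phi x - Phi y.
  have -> : gamma *: x - M x - gamma *: Phi x - (gamma *: y - M y - gamma *: Phi y)
      = (gamma *: (x - y) - (M x - M y)) - gamma *: d.
    have sub_sub (a b a' b' : X) : (a - b) - (a' - b') = (a - a') - (b - b').
      by rewrite opprD addrACA -opprD.
    by rewrite sub_sub (sub_sub (gamma *: x)) -!scalerBr.
  move/resolvent_le; set w := _ - (M x - M y) => dw.
  have ww : inner w w <= (gamma ^+ 2 - gamma * c) * inner (x - y) (x - y).
    have := MK x y; have := Mc x y; rewrite /w; move: (x - y) (M x - M y) => e n.
    rewrite !innerE (innerC n e) -gammaE.
    by have := inner_ge0 e; nra.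
  rewrite -(@ler_pM2l _ (gamma ^+ 2)) ?exprn_gt0// (le_trans dw)// (le_trans ww)//.
  rewrite le_eqVlt; apply/orP; left; apply/eqP; field; rewrite gt_eqF//.
have Ay : A y (- M y) by have := PhiA y; rewrite -yPhi addrAC subrr add0r; exact.
exists y; split=> // z Az; apply/subr0_eq/inner_eq0.
have := mA _ _ _ _ Ay Az; have := Mc y z; have := inner_ge0 (y - z).
rewrite -opprD innerNr oppr_ge0 => yz0 cyz Myz.
apply/eqP; rewrite eq_le yz0 andbT -(pmulr_rle0 _ c0).
exact: le_trans cyz Myz.
Qed.

(** A pair (x, u) monotonically related to the graph of M is tested against the
    points x - t d with d = Mx - u, and t tends to 0. *)
Lemma linear_maximally_monotone (M : {linear X -> X}) :
  (forall x, 0 <= inner x (M x)) -> maximally_monotone (op_fun M).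
Proof.
move=> M0; split=> [x _ y _ -> ->|B mB MB x u Bxu].
  by rewrite -linearB.
pose d := M x - u.
suff /inner_eq0/subr0_eq : inner d d = 0 by [].
apply/eqP; rewrite eq_le inner_ge0 andbT -oppr_ge0.
apply: (ge0_of_linear_perturbation (M0 d)) => t /andP[t0 _].
have := mB _ _ _ _ Bxu (MB (x - t *: d) _ erefl).
have -> : x - (x - t *: d) = t *: d by rewrite opprB addrC subrK.
have -> : u - M (x - t *: d) = t *: M d - d.
  by rewrite linearB linearZ /d !opprB addrCA.
by rewrite innerZl pmulr_rge0// innerDr innerZr innerNr addrC.
Qed.

End StronglyMonotoneInclusion.

(** * The cyclic shift and the operator Id/2 + T *)

Section CyclicShift.
Context (R : realType) (X : hilbertType R) (m : nat).
Implicit Types (x y z u : hpow X m).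

Lemma hpow_innerE x y : inner x y = \sum_(i < m) inner (x i) (y i).
Proof. by []. Qed.

Lemma inner_suml (I : Type) (r : seq I) (P : pred I) (F : I -> hpow X m) u :
  inner (\sum_(i <- r | P i) F i) u = \sum_(i <- r | P i) inner (F i) u.
Proof.
apply: (big_morph (fun x => inner x u)) => [x y|]; first exact: innerDl.
exact: inner0l.
Qed.

Lemma cshift_linear : linear (@cshift R X m).
Proof. by move=> a x y; apply/ffunP => i; rewrite !ffunE. Qed.

HB.instance Definition _ :=
  GRing.isLinear.Build R (hpow X m) (hpow X m) _ (@cshift R X m) cshift_linear.

Lemma iter_cshift_linear k : linear (iter k (@cshift R X m)).
Proof. by move=> a x y; elim: k => //= k ->; rewrite linearP. Qed.

Lemma iter_cshiftB k x y :
  iter k (@cshift R X m) (x - y) = iter k (@cshift R X m) x - iter k (@cshift R X m) y.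
Proof. by elim: k => //= k ->; rewrite linearB. Qed.

Lemma iter_cshiftE k x i : iter k (@cshift R X m) x i = x (iter k (@ord_pred m) i).
Proof. by elim: k x => // k IH x; rewrite iterSr IH ffunE. Qed.

Lemma iter_ord_pred k (i : 'I_m) : (k <= i)%N ->
  iter k (@ord_pred m) i = (i - k)%N :> nat.
Proof.
elim: k => [|k IH] ki /=; first by rewrite subn0.
have km := ltn_ord i.
rewrite IH ?(ltnW ki)// -[(_ + m).-1]/((_ + m).-1)%N.
have -> : ((i - k + m).-1 = m + (i - k.+1))%N by lia.
by rewrite modnDl modn_small// ; lia.
Qed.

Lemma iter_cshift_m x : iter m (@cshift R X m) x = x.
Proof.
apply/ffunP => i; rewrite iter_cshiftE; congr (x _); apply/val_inj => /=.
have im := ltn_ord i.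
(* Go down i steps to 0, one step to m - 1, then down to i again. *)
have -> : iter m (@ord_pred m) i =
    iter (m.-1 - i) (@ord_pred m) (ord_pred (iter i (@ord_pred m) i)).
  by rewrite -iterS -iterD; congr (iter _ _ _); lia.
have i0 : ord_pred (iter i (@ord_pred m) i) = m.-1 :> nat.
  by rewrite /= iter_ord_pred// subnn add0n modn_small//; lia.
by rewrite iter_ord_pred i0; lia.
Qed.

Lemma inner_cshift x y : inner (cshift x) (cshift y) = inner x y.
Proof.
rewrite !hpow_innerE [RHS](reindex_inj (@ord_pred_inj m)).
by apply: eq_bigr => i _; rewrite !ffunE.
Qed.

Lemma inner_iter_cshift k x y :
  inner (iter k (@cshift R X m) x) (iter k (@cshift R X m) y) = inner x y.
Proof. by elim: k => //= k <-; exact: inner_cshift. Qed.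

Lemma norm_iter_cshift k x : `|iter k (@cshift R X m) x| = `|x|.
Proof.
apply/eqP; rewrite -(@eqrXn2 _ 2)// -!innerxx; apply/eqP.
exact: inner_iter_cshift.
Qed.

Lemma cshift_fixed_diagonal x : cshift x = x -> diagonal_space x.
Proof.
move=> xE; case: (posnP m) => [m0|m0].
  by exists 0; apply/ffunP => i; have := ltn_ord i; lia.
exists (x (Ordinal m0)); apply/ffunP => i; rewrite ffunE.
have itx k : iter k (@cshift R X m) x = x by elim: k => //= k ->.
rewrite -{1}(itx i) iter_cshiftE; congr (x _); apply/val_inj => /=.
by rewrite iter_ord_pred// subnn.
Qed.

Lemma orth_cshift k y (u : hpow X m) : diagonal_space u ->
  inner (iter k (@cshift R X m) y) u = inner y u.
Proof.
move=> [v uE]; have uk : iter k (@cshift R X m) u = u.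
  by apply/ffunP => i; rewrite iter_cshiftE uE !ffunE.
by rewrite -[in LHS]uk inner_iter_cshift.
Qed.

(** The sum of all shifts of y is fixed by the shift, so it is diagonal, and
    it is orthogonal to the diagonal like y. *)
Lemma sum_iter_cshift y : orth (@diagonal_space R X m) y ->
  \sum_(0 <= k < m) iter k (@cshift R X m) y = 0.
Proof.
move=> yo; set w := LHS.
have wd : diagonal_space w.
  apply: cshift_fixed_diagonal; apply/subr0_eq.
  rewrite /w linear_sum -sumrB (telescope_sumr (fun k => iter k _ y))//=.
  by rewrite iter_cshift_m subrr.
apply: inner_eq0; rewrite {1}/w inner_suml big1// => k _.
by rewrite orth_cshift// yo.
Qed.

Definition half_add_cycle y : hpow X m := 2^-1 *: y + cycle_op y.

Lemma cycle_op_linear : linear (@cycle_op R X m).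
Proof.
move=> a x y; rewrite /cycle_op scalerA (mulrC a) -scalerA -scalerDr.
congr (_ *: _); rewrite scaler_sumr -big_split/=; apply: eq_bigr => k _.
by rewrite iter_cshift_linear scalerDr !scalerA (mulrC a).
Qed.

HB.instance Definition _ :=
  GRing.isLinear.Build R (hpow X m) (hpow X m) _ (@cycle_op R X m)
    cycle_op_linear.

Lemma half_add_cycle_linear : linear half_add_cycle.
Proof.
move=> a x y; rewrite /half_add_cycle cycle_op_linear scalerDr.
by rewrite addrACA [in RHS]scalerDr !scalerA (mulrC a 2^-1).
Qed.

HB.instance Definition _ :=
  GRing.isLinear.Build R (hpow X m) (hpow X m) _ half_add_cycle
    half_add_cycle_linear.

Lemma inner_half_add_cycle y u : inner (half_add_cycle y) u =
  2^-1 * inner y u + (2 * m)%:R^-1 *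
    \sum_(1 <= k < m) (m%:R - (2 * k)%:R) * inner (iter k (@cshift R X m) y) u.
Proof.
rewrite /half_add_cycle innerDl !innerZl inner_suml; congr (_ + _ * _).
by apply: eq_bigr => k _; rewrite innerZl.
Qed.

(** T is skew: the substitution k -> m - k fixes <R^k x, x>, as R is an
    isometry of order m, and changes the sign of m - 2k. *)
Lemma half_add_cycle_coercive x : inner x (half_add_cycle x) = 2^-1 * inner x x.
Proof.
rewrite innerC inner_half_add_cycle; set S := \sum_(_ <= _ < _) _.
suff SN : S = - S by have -> : S = 0; [lra | rewrite mulr0 addr0].
rewrite /S [LHS]big_nat_rev -sumrN; apply: eq_big_nat => k /andP[k1 km].
have -> : (1 + m - k.+1 = m - k)%N by lia.
have -> : inner (iter (m - k) (@cshift R X m) x) x =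
    inner (iter k (@cshift R X m) x) x.
  rewrite -(inner_iter_cshift k) -iterD subnKC ?(ltnW km)//.
  by rewrite iter_cshift_m innerC.
rewrite -mulNr mulnBr natrB ?leq_mul2l ?(ltnW km)//; congr (_ * _).
by rewrite !natrM; ring.
Qed.

Lemma half_add_cycle_bounded :
  exists L : R, forall x, inner (half_add_cycle x) (half_add_cycle x) <= L * inner x x.
Proof.
pose C : R := 2^-1 + `|(2 * m)%:R^-1 : R| * \sum_(1 <= k < m) `|m%:R - (2 * k)%:R|.
have xC x : `|half_add_cycle x| <= C * `|x|.
  rewrite (le_trans (ler_normD _ _))// mulrDl lerD//.
    by rewrite normrZ ger0_norm// invr_ge0.
  rewrite normrZ -mulrA ler_wpM2l// mulr_suml (le_trans (ler_norm_sum _ _ _))//.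
  by apply: ler_sum => k _; rewrite normrZ norm_iter_cshift.
exists (C ^+ 2) => x; rewrite !innerxx -exprMn ler_pXn2r// nnegrE//.
exact: le_trans (xC x).
Qed.

Lemma half_add_cycle_orth y : orth (@diagonal_space R X m) y ->
  orth (@diagonal_space R X m) (half_add_cycle y).
Proof.
move=> yo u ud; rewrite inner_half_add_cycle yo// big1 ?mulr0 ?addr0//.
by move=> k _; rewrite orth_cshift// yo// mulr0.
Qed.

(** The term m/(2m) of M is the summand k = 0 of the sum that defines T, so
    2m M(y - Ry) is the sum over 0 <= k < m of (m - 2k) (R^k y - R^(k+1) y).
    Summation by parts turns it into 2m y minus twice the sum of all shifts. *)
Lemma half_add_cycleK y : (0 < m)%N -> orth (@diagonal_space R X m) y ->
  half_add_cycle (y - cshift y) = y.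
Proof.
move=> m0 yo; apply: inner_ext => u; rewrite inner_half_add_cycle.
pose s k := inner (iter k (@cshift R X m) y) u.
have sE k : inner (iter k (@cshift R X m) (y - cshift y)) u = s k - s k.+1.
  by rewrite iter_cshiftB -iterSr innerDl innerNl.
have mR : m%:R != 0 :> R by rewrite pnatr_eq0 -lt0n.
have -> : inner (y - cshift y) u = s 0%N - s 1%N by rewrite innerDl innerNl.
under eq_bigr do rewrite sE.
have abel n : \sum_(0 <= k < n) (m%:R - (2 * k)%:R) * (s k - s k.+1) =
    (m%:R + 2) * s 0%N - (m%:R - (2 * n)%:R + 2) * s n
    - 2 * \sum_(0 <= k < n) s k.
  elim: n => [|n IH]; first by rewrite !big_geq// muln0; ring.
  by rewrite !big_nat_recr//= IH !natrM -natr1; ring.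
have sm : s m = s 0%N by rewrite /s iter_cshift_m.
have s0 : \sum_(0 <= k < m) s k = 0.
  by rewrite -inner_suml sum_iter_cshift// inner0l.
have := abel m; rewrite s0 sm (big_ltn m0) muln0 subr0 natrM => ab.
have -> : \sum_(1 <= k < m) (m%:R - (2 * k)%:R) * (s k - s k.+1) =
    2 * m%:R * s 0%N - m%:R * (s 0%N - s 1%N) by lra.
by rewrite [RHS]/(s 0%N); field.
Qed.

End CyclicShift.

(** * The cyclic problems *)

Theorem theorem4p2 (R : realType) (X : hilbertType R) (m : nat)
    (f : 'I_m -> X -> \bar R)
    (m_gt0 : (0 < m)%N)
    (f_proper : forall i, proper_efun (f i))
    (f_lsc : forall i, lower_semicontinuous (f i))
    (f_convex : forall i, convex_efun (f i))
    (dom_meets :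
      edom (fenchel_conj (sep_sum f)) `&` orth (@diagonal_space R X m) !=set0) :
  (exists! y : hpow X m, problemD f y) /\
  (is_attouch_thera_dual
     (subdiff (fenchel_conj (sep_sum f) \+
               fenchel_conj (indicator (@diagonal_space R X m)))%E)
     (op_fun (fun y : hpow X m => 2^-1 *: y + cycle_op y))
     (problemD f) (problemP f) /\
   exists! x : hpow X m, problemP f x).
Proof.
pose D := @diagonal_space R X m.
pose F := sep_sum f; pose k := infconv F (@indicator R (hpow X m) D).
pose M := @half_add_cycle R X m.
have D0 : D !=set0 by exists 0, 0; apply/ffunP => i; rewrite !ffunE.
have DZ (t : R) u : D u -> D (t *: u).
  by move=> [v ->]; exists (t *: v); apply/ffunP => i; rewrite !ffunE.
have Dcvx (t : R) u v : D u -> D v -> D (t *: u + (1 - t) *: v).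
  move=> [u' ->] [v' ->]; exists (t *: u' + (1 - t) *: v').
  by apply/ffunP => i; rewrite !ffunE.
have F_proper := proper_sep_sum f_proper.
have ind_proper := proper_indicator D0.
have kcvx : epi_convex k.
  apply: epi_convex_infconv => //; last exact: epi_convex_indicator.
  by apply: convex_epi_convex (convex_sep_sum f_proper f_convex) => x; exact: F_proper.1.
have k_dom : edom k !=set0 by exact: infconv_edom.
have kE : fenchel_conj k =
    (fenchel_conj F \+ fenchel_conj (@indicator R (hpow X m) D))%E.
  by apply/funext => v; exact: fenchel_conj_infconv.
have conj_dom : edom (fenchel_conj k) !=set0.
  have [w [Fw wD]] := dom_meets; exists w; rewrite kE /edom/=.
  apply: (@le_lt_trans _ _ (fenchel_conj F w + 0)%E).
    by rewrite leeD2l// fenchel_conj_indicator_orth.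
  by rewrite adde0.
have conj_orth y : edom (fenchel_conj k) y -> orth D y.
  rewrite kE /edom/= => ky; apply: fenchel_conj_indicator_edom => //.
  move: ky; rewrite /edom/=.
  have := fenchel_conj_gtNy y F_proper.2.
  case: (fenchel_conj (indicator D) y) => [s| |]; rewrite ?ltry//.
  by case: (fenchel_conj F y).
have MB u v : M u - M v = M (u - v) by rewrite /M linearB.
have MN v : M (- v) = - M v by rewrite /M linearN.
have [L ML] := half_add_cycle_bounded X m.
have [y0 [Ay0 y0_unique]] : exists! y, subdiff (fenchel_conj k) y (- M y).
  apply: (@strongly_monotone_inclusion _ _ _ M 2^-1 L).
  - by rewrite invr_gt0.
  - by move=> x y; rewrite MB half_add_cycle_coercive.
  - by move=> x y; rewrite MB.
  - exact: subdiff_monotone (proper_fenchel_conj k_dom conj_dom).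
  - by move=> gamma x; exact: subdiff_conj_resolvent.
have DE y : problemD f y <-> subdiff (fenchel_conj k) y (- M y).
  rewrite kE /problemD /zeros /op_add /op_fun/=; split.
    by move=> [u uA [_ ->]] /eqP; rewrite addr_eq0 => /eqP <-.
  by move=> uA; exists (- M y) => //; exists (M y) => //; rewrite addNr.
have dualE x : zeros (attouch_thera_dual (subdiff (fenchel_conj k)) (op_fun M)) x <->
    exists2 y, subdiff (fenchel_conj k) y x & M y = - x.
  split=> [[y yA [_ [w wM <-]]] /subr0_eq yw|[y yA yM]].
    by exists y; rewrite // yw wM.
  by exists y => //; exists (- y); [exists y|rewrite subrr].
have PE x : problemP f x <->
    exists2 y, subdiff (fenchel_conj k) y x & M y = - x.
  split=> [[[u uA [_ ->]] /eqP + xD]|[y yA yM]].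
    rewrite addr_eq0 => /eqP uE; exists u; first exact/(subdiff_lsc_hull kcvx k_dom conj_dom).
    by rewrite uE MN /M half_add_cycleK.
  have yD : orth D y.
    by apply: conj_orth; exact: subdiff_edom (proper_fenchel_conj k_dom conj_dom) yA.
  have MyD : orth D (M y) by exact: half_add_cycle_orth.
  have xE : x = - M y by rewrite yM opprK.
  (* M is injective and sends both sides to M y. *)
  have yE : y = M y - cshift (M y).
    apply/subr0_eq/inner_eq0; set z := y - _.
    have Mz : M z = 0 by rewrite /z -MB /M half_add_cycleK// subrr.
    have := half_add_cycle_coercive z; rewrite -/M Mz inner0r; lra.
  split; last first.
    by move=> u uD; rewrite xE innerNl MyD// oppr0.
  exists y; first exact/(subdiff_lsc_hull kcvx k_dom conj_dom).
  exists (x - cshift x) => //.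
  by rewrite xE linearN {1}yE -opprD subrr.
split; first by exists y0; split=> [|z /DE /y0_unique]; first exact/DE.
split.
  split=> //.
  - by have := subdiff_conj_maximally_monotone kcvx k_dom conj_dom; rewrite kE.
  - apply: (@linear_maximally_monotone _ _ M) => x.
    by rewrite half_add_cycle_coercive mulr_ge0 ?invr_ge0 ?inner_ge0.
  - by apply/seteqP; rewrite -kE; split=> x; [move=> /PE/dualE|move=> /dualE/PE].
exists (- M y0); split; first by apply/PE; exists y0 => //; rewrite opprK.
move=> x /PE[y yA yM]; have xE : x = - M y by rewrite yM opprK.
by rewrite xE (y0_unique y)// -xE.
Qed.
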